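(* For all integers $m\ge k\ge 1$ and $n\ge 0$, the map $\mathrm{pre}_k$ is injective on the set of $m$-ary partitions of $n$ (of length at least $k$).
   Context: A partition $\lambda=(\lambda_1,\dots,\lambda_\ell)$ of $n$ is a nonincreasing sequence of positive integers summing to $n$; $\ell$ is its length. An $m$-ary partition is a partition all of whose parts are powers $m^a$ with $a\ge 0$ an integer (so $1=m^0$ is allowed as a part). For a partition $\lambda$ of length $\ell\ge k$, $\mathrm{pre}_k(\lambda)$ is the partition whose parts (with multiplicity) are the summands of the elementary symmetric polynomial $e_k(\lambda_1,\dots,\lambda_\ell)$, i.e. the multiset of all products $\lambda_{i_1}\cdots\lambda_{i_k}$ over $1\le i_1<\cdots<i_k\le \ell$, sorted in nonincreasing order. The map $\mathrm{pre}_k$ is only defined on partitions of length at least $k$, and ''the set of partitions of $n$'' as a domain of $\mathrm{pre}_k$ means those of length at least $k$. *)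

(* Defs.v *)
From mathcomp Require Import all_boot.

Set Implicit Arguments.
Unset Strict Implicit.
Unset Printing Implicit Defensive.

Definition is_partition (n : nat) (s : seq nat) : Prop :=
  [/\ sorted geq s, all (fun x => 0 < x) s & sumn s = n].

(* The exponent 0 is allowed, so 1 may occur as a part. *)
Definition mary (m : nat) (s : seq nat) : Prop :=
  forall x, x \in s -> exists a : nat, x = m ^ a.

(* One product per k-element set of indices (not of values), so that the
   products are listed with multiplicity. *)
Definition esym_summands (k : nat) (s : seq nat) : seq nat :=
  [seq \prod_(i in A) nth 0 s i
     | A : {set 'I_(size s)} in [set B : {set 'I_(size s)} | #|B| == k]].

(* Total on sequences; mathematically meaningful only when k <= size s (for
   shorter s the value is the empty sequence). *)
Definition pre (k : nat) (s : seq nat) : seq nat :=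
  sort geq (esym_summands k s).

Definition pre_dom (m k n : nat) (s : seq nat) : Prop :=
  [/\ is_partition n s, mary m s & k <= size s].

(* Main.v *)
Require Import Defs.
From mathcomp Require Import all_boot.

(** Why the map is injective. List the parts of two different m-ary partitions
    of n in nondecreasing order and remove the longest common prefix.  Let q be
    the smaller of the two next parts, so that the remainder of one list, say
    [s], contains q some [a > 0] times and every part remaining in the other,
    [t], exceeds q.  Larger powers of m are multiples of [m * q], so comparing
    the two equal sums modulo [m * q] gives [m %| a]; hence [k <= m <= a]
    ([leq_count_of_sumn]).

    Consequently, for each [1 <= i <= k], the number [q ^ i] is a product of i
    parts of [s], whereas all products of i parts of [t] are larger: the
    smallest value at which the multisets of i-fold products have different
    multiplicities is [q ^ i], and it is in excess on the side of [s]
    ([first_excess_base]).  Restoring the common parts one by one, from the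
    largest to the smallest, preserves the existence, for every [i <= k], of a
    first differing value with an excess on the side of [s]
    ([first_excess_cons]): the i-fold products of [x :: s] are those of [s]
    together with x times the (i-1)-fold products of [s], and since x is at
    most every part present, no cancellation can occur at the smallest
    difference.  For [i = k] the multisets of k-fold products differ. *)

(** * Products of k entries of a sequence *)

Fixpoint kprods (k : nat) (s : seq nat) : seq nat :=
  match k, s with
  | 0, _ => [:: 1]
  | _.+1, [::] => [::]
  | k'.+1, x :: s' => kprods k s' ++ map (muln x) (kprods k' s')
  end.

Lemma kprods0 s : kprods 0 s = [:: 1].
Proof. by case: s. Qed.

Lemma count_kprodsS k x s (P : pred nat) :
  count P (kprods k.+1 (x :: s)) =
  count P (kprods k.+1 s) + count (P \o muln x) (kprods k s).
Proof. by rewrite /= count_cat count_map. Qed.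

Lemma ord_max_notin_lift n (B : {set 'I_n}) : ord_max \notin lift ord_max @: B.
Proof. by apply/imsetP => -[j _ /eqP]; rewrite (negPf (neq_lift _ _)). Qed.

(** The subsets of ['I_n.+1] avoiding, resp. containing, the last index are
    the images of the subsets of ['I_n]; this is the recursion of [kprods]. *)
Lemma sum_set_ord_recr n (F : {set 'I_n.+1} -> nat) :
  \sum_A F A = \sum_(B : {set 'I_n}) F (lift ord_max @: B)
             + \sum_(B : {set 'I_n}) F (ord_max |: lift ord_max @: B).
Proof.
have liftI : injective (lift (@ord_max n)) by apply: lift_inj.
have mem_lift (B : {set 'I_n}) j : (lift ord_max j \in lift ord_max @: B) = (j \in B).
  by rewrite mem_imset.
rewrite (bigID (fun A : {set 'I_n.+1} => ord_max \notin A)) /=; congr (_ + _).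
- rewrite (reindex (fun B : {set 'I_n} => lift ord_max @: B)) /=.
    by apply: eq_bigl => B; rewrite ord_max_notin_lift.
  exists (fun A : {set 'I_n.+1} => [set j : 'I_n | lift ord_max j \in A]) => [B _ | A maxA].
    by apply/setP => j; rewrite inE mem_lift.
  apply/setP => i; case: (unliftP ord_max i) => [j -> | ->].
    by rewrite mem_lift inE.
  by rewrite (negPf (ord_max_notin_lift _ _)) (negPf maxA).
- rewrite (reindex (fun B : {set 'I_n} => ord_max |: lift ord_max @: B)) /=.
    by apply: eq_bigl => B; rewrite setU11.
  exists (fun A : {set 'I_n.+1} => [set j : 'I_n | lift ord_max j \in A]) => [B _ | A].
    by apply/setP => j; rewrite !inE eq_sym (negPf (neq_lift _ _)) mem_lift.
  rewrite inE negbK => maxA; apply/setP => i.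
  case: (unliftP ord_max i) => [j -> | ->].
    by rewrite !inE eq_sym (negPf (neq_lift _ _)) mem_lift inE.
  by rewrite setU11 maxA.
Qed.

(** Splitting off the last index peels [f] from its last value, hence the
    reversal on the right. *)
Lemma count_subset_prods k n (f : nat -> nat) (P : pred nat) :
  \sum_(A : {set 'I_n} | #|A| == k) P (\prod_(i in A) f i) =
  count P (kprods k (rev (mkseq f n))).
Proof.
elim: n k P => [|n IHn] k P.
  have only0 (A : {set 'I_0}) : A = set0 by apply/setP => -[].
  rewrite (eq_bigl (fun A : {set 'I_0} => (A == set0) && (0 == k))).
    case: k => [|k]; last by rewrite big_pred0 // => A; rewrite andbF.
    by rewrite (big_pred1 set0) ?big_set0 ?kprods0 /= ?addn0 // => A; rewrite andbT.
  by move=> A; rewrite (only0 A) cards0 eqxx.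
have liftI : injective (lift (@ord_max n)) by apply: lift_inj.
have prod_lift (B : {set 'I_n}) :
    \prod_(i in lift ord_max @: B) f i = \prod_(i in B) f i.
  rewrite big_imset /=; last by move=> i j _ _ /liftI.
  by apply: eq_bigr => i _; congr f; apply: lift_max.
rewrite big_mkcond sum_set_ord_recr /= mkseqS rev_rcons.
under eq_bigr do rewrite card_imset // prod_lift.
under [X in _ + X]eq_bigr do
  rewrite cardsU1 ord_max_notin_lift card_imset // big_setU1 ?ord_max_notin_lift // prod_lift.
rewrite -!big_mkcond /= IHn; case: k => [|k].
  by rewrite !kprods0 big_pred0 ?addn0.
by rewrite count_cat count_map; congr (_ + _); rewrite -IHn.
Qed.

Lemma perm_esym_summands k s : perm_eq (esym_summands k s) (kprods k (rev s)).
Proof.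
apply/permP => P.
rewrite -{2}(mkseq_nth 0 s) -count_subset_prods /esym_summands.
rewrite count_map -sum1_count big_mkcond big_enum /= [RHS]big_mkcond [LHS]big_mkcond.
by apply: eq_bigr => A _; rewrite inE; case: ifP => //= _; case: (P _).
Qed.

Lemma kprods_ge q k s : all (leq q) s -> all (leq (q ^ k)) (kprods k s).
Proof.
elim: s k => [|x s IHs] [|k] //= /andP[qx qs].
rewrite all_cat (IHs k.+1 qs) all_map; apply: sub_all (IHs k qs) => z qz /=.
by rewrite expnS leq_mul.
Qed.

Lemma kprods_gt q k s : all (ltn q) s -> all (ltn (q ^ k.+1)) (kprods k.+1 s).
Proof.
elim: s k => [|x s IHs] k //= /andP[qx qs].
rewrite all_cat (IHs k qs) all_map /=.
have qs' : all (leq q) s by apply: sub_all qs => z /ltnW.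
case: (posnP q) => [q0 | q_gt0].
  rewrite q0 exp0n //; rewrite q0 in qs qx.
  have : all (leq (1 ^ k)) (kprods k s) by apply: kprods_ge.
  by rewrite exp1n; apply: sub_all => z z_gt0; rewrite /= muln_gt0 qx.
apply: sub_all (kprods_ge q k s qs') => z qz /=.
by rewrite expnS (leq_ltn_trans (leq_mul (leqnn q) qz)) // ltn_pmul2r //
           (leq_trans _ qz) ?expn_gt0 ?q_gt0.
Qed.

Lemma mem_kprods_expn q k s : k <= count_mem q s -> q ^ k \in kprods k s.
Proof.
elim: s k => [|x s IHs] [|k] //=.
rewrite mem_cat; case: eqP => [-> | _] /= le_k.
  by rewrite expnS (map_f (muln q)) ?orbT // IHs.
by rewrite IHs.
Qed.

(** * The first difference between two multisets of products *)

(** The growth condition on [mu] makes the property inductive: it compares the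
    two contributions to the products that result from adjoining a new part
    not exceeding [x]. *)
Definition first_excess (k x : nat) (s t : seq nat) : Prop :=
  exists mu : nat -> nat, forall i, 0 < i <= k ->
  [/\ count_mem (mu i) (kprods i t) < count_mem (mu i) (kprods i s),
      forall M, M < mu i -> count_mem M (kprods i s) = count_mem M (kprods i t)
    & x * mu i <= mu i.+1].

Lemma first_excess_weaken k x y s t :
  x <= y -> first_excess k y s t -> first_excess k x s t.
Proof.
move=> xy [mu Hmu]; exists mu => i /Hmu[excess agree growth]; split=> //.
by apply: leq_trans growth; rewrite leq_mul2r xy orbT.
Qed.

Lemma count_eq_mull x M (s : seq nat) : 0 < x ->
  count (pred1 M \o muln x) s = if x %| M then count_mem (M %/ x) s else 0.
Proof.
move=> x_gt0; case: ifP => [xM | xM].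
  by apply: eq_count => z /=; rewrite eq_sym eqn_div // eq_sym mulnC.
rewrite -(count_pred0 s); apply: eq_count => z /=.
by apply/eqP => E; rewrite -E dvdn_mulr in xM.
Qed.

(** At degree [i.+1] the new first difference is [x] times the old one of
    degree [i], which is no larger than the old one of degree [i.+1]; if the
    two coincide, two excesses of the same sign add up.  At degree 1 the
    contribution of the new part is the same on both sides. *)
Lemma first_excess_cons k x s t : 0 < x ->
  first_excess k x s t -> first_excess k x (x :: s) (x :: t).
Proof.
move=> x_gt0 [mu Hmu].
exists (fun i => if i is j.+2 then x * mu j.+1 else mu i) => -[|[|i]] //.
  move=> /Hmu[excess agree _]; split=> // [|M ltM].
    by rewrite !count_kprodsS !kprods0 ltn_add2r.
  by rewrite !count_kprodsS !kprods0 agree.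
move=> /= lt_ik.
have [excess agree growth] := Hmu i.+1 (ltnW lt_ik).
have [excess' agree' growth'] := Hmu i.+2 lt_ik.
split=> [|M ltM|]; last by rewrite leq_mul2l growth orbT.
  rewrite !count_kprodsS !count_eq_mull // dvdn_mulr // mulKn //.
  rewrite -addnS leq_add //.
  move: growth; rewrite leq_eqVlt => /predU1P[-> | lt_mu]; first exact: ltnW.
  by rewrite agree'.
rewrite !count_kprodsS !count_eq_mull // agree' ?(leq_trans ltM) //.
case: ifP => // /dvdnP[z defM]; congr (_ + _).
by apply: agree; rewrite defM mulnK // -(ltn_pmul2l x_gt0) mulnC -defM.
Qed.

(** All products of [i] entries of [s] are at least [q ^ i], a value that is
    reached when [s] has [i] copies of [q] and is out of reach for [t]. *)
Lemma first_excess_base k q s t :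
    all (leq q) s -> all (ltn q) t -> k <= count_mem q s ->
  first_excess k q s t.
Proof.
move=> qs qt le_k; exists (expn q) => -[|i] //= lt_ik.
have no_t M : M <= q ^ i.+1 -> count_mem M (kprods i.+1 t) = 0.
  move=> leM; apply/count_memPn/negP => /(allP (kprods_gt q i t qt)).
  by rewrite /= ltnNge leM.
split=> [|M ltM|]; last by rewrite -expnS.
  rewrite no_t // -has_count has_pred1.
  by apply: mem_kprods_expn; apply: leq_trans le_k.
rewrite no_t ?(ltnW ltM) //.
apply/count_memPn/negP => /(allP (kprods_ge q i.+1 s qs)).
by rewrite /= leqNgt ltM.
Qed.

(** * Sums of powers of m *)

Lemma dvdn_pow_lt m a b : 0 < m -> m ^ a < m ^ b -> m * m ^ a %| m ^ b.
Proof.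
move=> m_gt0 lt_ab; rewrite -expnS dvdn_exp2l // ltnNge; apply/negP => le_ba.
by move: lt_ab; rewrite ltnNge leq_pexp2l.
Qed.

Lemma sumn_mod_count d q s :
    (forall z, z \in s -> z = q \/ d %| z) ->
  sumn s = q * count_mem q s %[mod d].
Proof.
elim: s => [|x s IHs] Hs /=; first by rewrite muln0.
have IH : sumn s = q * count_mem q s %[mod d].
  by apply: IHs => z zs; apply: Hs; rewrite inE zs orbT.
rewrite -modnDmr IH modnDmr; case: eqP => [-> | neq_xq].
  by rewrite mulnDr muln1.
have [// | dx] := Hs x (mem_head _ _).
by rewrite add0n -modnDml (eqP dx).
Qed.

(** A part at least [q] is [q] or a multiple of [m * q], so modulo [m * q] the
    two sums are [q] times the number of copies of [q], and 0. *)
Lemma leq_count_of_sumn m q s t : 0 < m ->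
    mary m (q :: s) -> mary m t -> all (leq q) s -> all (ltn q) t ->
    sumn (q :: s) = sumn t ->
  m <= count_mem q (q :: s).
Proof.
move=> m_gt0 ms mt qs qt eq_sum.
have [a qE] := ms q (mem_head _ _).
have q_gt0 : 0 < q by rewrite qE expn_gt0 m_gt0.
have mult z : (exists b, z = m ^ b) -> q < z -> m * q %| z.
  by move=> [b ->]; rewrite qE; apply: dvdn_pow_lt.
have s_mod : sumn (q :: s) = q * count_mem q (q :: s) %[mod m * q].
  apply: sumn_mod_count => z zs.
  have : q <= z by move: zs; rewrite inE => /predU1P[-> // | /(allP qs)].
  by rewrite leq_eqVlt => /predU1P[-> | /mult dz]; [left | right; apply: dz; apply: ms].
have t_mod : sumn t = q * count_mem q t %[mod m * q].
  by apply: sumn_mod_count => z zt; right; apply: mult (mt z zt) (allP qt z zt).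
have t0 : count_mem q t = 0.
  by apply/count_memPn/negP => /(allP qt); rewrite /= ltnn.
move: s_mod; rewrite eq_sum t_mod t0 muln0 mod0n => /esym/eqP.
rewrite -/(dvdn _ _) mulnC dvdn_pmul2l // => /dvdn_leq; apply.
by rewrite /= eqxx.
Qed.

(** * Injectivity *)

Lemma first_excess_of_neq m k x s t : 0 < m -> k <= m ->
    path leq x s -> path leq x t -> mary m s -> mary m t ->
    sumn s = sumn t -> s <> t ->
  first_excess k x s t \/ first_excess k x t s.
Proof.
move=> m_gt0 le_km.
have base y q s' t' : y <= q -> path leq q s' -> all (ltn q) t' ->
    mary m (q :: s') -> mary m t' -> sumn (q :: s') = sumn t' ->
    first_excess k y (q :: s') t'.
  move=> yq /(order_path_min leq_trans) qs qt ms mt eq_sum.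
  apply: (first_excess_weaken _ _ _ _ _ yq).
  apply: first_excess_base => //; first by rewrite /= leqnn.
  exact: leq_trans le_km (leq_count_of_sumn _ _ _ _ m_gt0 ms mt qs qt eq_sum).
have gt_all q h t' : q < h -> path leq h t' -> all (ltn q) (h :: t').
  move=> qh /(order_path_min leq_trans) ht; rewrite /= qh.
  by apply: sub_all ht => z; apply: leq_trans.
elim: s x t => [|q s IHs] x [|h t] //=.
- by move=> _ /andP[xh ht] ms mt eq_sum _; right; apply: base.
- by move=> /andP[xq qs] _ ms mt eq_sum _; left; apply: base.
move=> /andP[xq qs] /andP[xh ht] ms mt eq_sum neq_st.
case: (ltngtP q h) => [qh | hq | eq_qh].
- by left; apply: base => //; apply: gt_all.
- by right; apply: base => //; apply: gt_all.
subst h.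
have q_gt0 : 0 < q by have [a ->] := ms q (mem_head _ _); rewrite expn_gt0 m_gt0.
have ms' : mary m s by move=> z zs; apply: ms; rewrite inE zs orbT.
have mt' : mary m t by move=> z zt; apply: mt; rewrite inE zt orbT.
have [] := IHs q t qs ht ms' mt' (addnI eq_sum); first by move=> E; rewrite E in neq_st.
- by move=> H; left; apply: (first_excess_weaken _ _ _ _ _ xq); apply: first_excess_cons.
- by move=> H; right; apply: (first_excess_weaken _ _ _ _ _ xq); apply: first_excess_cons.
Qed.

Lemma first_excess_not_perm k x s t : 0 < k ->
  first_excess k x s t -> ~ perm_eq (kprods k s) (kprods k t).
Proof.
move=> k_gt0 [mu /(_ k)]; rewrite k_gt0 leqnn => -[] // excess _ _ /permP E.
by rewrite E ltnn in excess.
Qed.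

Theorem theorem1p4 (m k n : nat) (hk : 1 <= k) (hkm : k <= m)
    (s t : seq nat) (hs : pre_dom m k n s) (ht : pre_dom m k n t) :
  pre k s = pre k t -> s = t.
Proof.
move=> eq_pre; case: hs => -[s_sorted _ s_sum] ms _.
case: ht => -[t_sorted _ t_sum] mt _.
have eq_kprods : perm_eq (kprods k (rev s)) (kprods k (rev t)).
  rewrite -(permPl (perm_esym_summands k s)) -(permPr (perm_esym_summands k t)).
  by rewrite -(perm_sort geq) -/(pre k s) eq_pre perm_sort.
have path_rev u : sorted geq u -> path leq 0 (rev u).
  by rewrite -[sorted geq u]rev_sorted; case: (rev u).
have mary_rev u : mary m u -> mary m (rev u).
  by move=> mu z; rewrite mem_rev; apply: mu.
apply/eqP/negPn/negP => /eqP neq_st.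
have [] := first_excess_of_neq m k 0 (rev s) (rev t) (leq_trans hk hkm) hkm
  (path_rev s s_sorted) (path_rev t t_sorted) (mary_rev s ms) (mary_rev t mt).
- by rewrite !sumn_rev s_sum t_sum.
- by move/(can_inj revK).
- by move/(first_excess_not_perm _ _ _ _ hk).
- by move/(first_excess_not_perm _ _ _ _ hk); rewrite perm_sym.
Qed.
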